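(* Let $P_1$ and $P_2$ be real constant coefficient ordinary differential operators with characteristic polynomials $\mathcal{P}_1$ and $\mathcal{P}_2$, and let $\Sigma(t_1,t_2)=\sigma_1(t_1)\otimes\sigma_2(t_2)$ be the associated surface, with mean curvature vector $H$. Assume that the roots $r_1>\dots>r_k$ of $\mathcal{P}_1$ and $s_1>\dots>s_\ell$ of $\mathcal{P}_2$ are all real and simple, and that the real roots are dominant. Assume that $r_1>r_2>0>r_{k-1}>r_k$ and that $s_1>s_2>0>s_{\ell-1}>s_\ell$. Then: (1) There exist $\epsilon=\epsilon(\Sigma)>0$ and $C=C(\Sigma)>0$ so that $\|H\|\le Ce^{-\epsilon\|(t_1,t_2)\|}$ for all $(t_1,t_2)\in\mathbb{R}^2$. (2) $H\in L^3(\Sigma,\operatorname{dvol})$, i.e. $\int_{\mathbb{R}^2}\|H\|^3\,g\,dt_1dt_2<\infty$.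
   Context: Here $\mathcal{P}_1$ has degree $k$ and $\mathcal{P}_2$ has degree $\ell$ (all roots real and simple). ''The real roots are dominant'' means $r_1>0>r_k$ and $s_1>0>s_\ell$. The associated curves are $\sigma_1(t_1)=(e^{r_1t_1},\dots,e^{r_kt_1})$ and $\sigma_2(t_2)=(e^{s_1t_2},\dots,e^{s_\ell t_2})$, and $\Sigma:\mathbb{R}^2\to\mathbb{R}^{k\ell}$ is $\Sigma(t_1,t_2)=\sigma_1(t_1)\otimes\sigma_2(t_2)$, i.e. its coordinates are $e^{r_it_1+s_jt_2}$ for $1\le i\le k$, $1\le j\le\ell$; $\mathbb{R}^{k\ell}$ carries the standard Euclidean inner product. $\Sigma$ is an immersion. Put $g_{ij}=(\partial_{t_i}\Sigma,\partial_{t_j}\Sigma)$, $g=\sqrt{g_{11}g_{22}-g_{12}^2}$, $\operatorname{dvol}=g\,dt_1dt_2$, and let $(g^{ij})$ be the inverse matrix of $(g_{ij})$. The second fundamental form $L_{ij}$ is the orthogonal projection of $\partial_{t_i}\partial_{t_j}\Sigma$ on the normal space $T\Sigma^\perp$, and the mean curvature vector is $H=\sum_{i,j}g^{ij}L_{ij}\in T\Sigma^\perp$. *)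

(* Defs.v *)
From HB Require Import structures.
From mathcomp Require Import all_boot all_order all_algebra.
From mathcomp Require Import all_classical all_reals all_analysis.
From mathcomp Require mxtens.

Set Implicit Arguments.
Unset Strict Implicit.
Unset Printing Implicit Defensive.

Import Order.TTheory GRing.Theory Num.Theory.
Import numFieldNormedType.Exports.

Local Open Scope classical_set_scope.
Local Open Scope ring_scope.

Definition smooth (R : realType) (phi : R -> R) : Prop :=
  forall (n : nat) (t : R), derivable (derive1n n phi) t 1.

(* P is the constant coefficient operator p(d/dt), i.e. p is its
   characteristic polynomial; the operator is only constrained on smooth
   functions. *)
Definition has_charpoly (R : realType) (P : (R -> R) -> R -> R)
    (p : {poly R}) : Prop :=
  forall phi : R -> R, smooth phi ->
    forall t : R, P phi t = \sum_(i < size p) p`_i * derive1n i phi t.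

(* p has degree k, and its complex roots are exactly the k distinct real
   numbers r`_0 > ... > r`_(k-1), each of multiplicity one. *)
Definition real_simple_roots (R : realType) (p : {poly R}) (k : nat)
    (r : k.-tuple R) : Prop :=
  [/\ size p = k.+1,
      sorted >%R r
    & p = lead_coef p *: \prod_(a <- r) ('X - a%:P)].

Definition dominant_real_roots (R : realType) (k : nat) (r : k.-tuple R) :
    Prop := r`_0 > 0 /\ 0 > r`_k.-1.

Definition exp_curve (R : realType) (k : nat) (r : k.-tuple R) (t : R) :
    'rV[R]_k := \row_i expR (tnth r i * t).

Definition exp_surface (R : realType) (k l : nat) (r : k.-tuple R)
    (s : l.-tuple R) (t : R * R) : 'rV[R]_(k * l) :=
  mxtens.tensmx (exp_curve r t.1) (exp_curve s t.2).

(* The library's norms on R * R and 'rV[R]_n are sup norms, so the Euclidean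
   inner product and norms are introduced explicitly. *)
Definition dot (R : realType) (n : nat) (u v : 'rV[R]_n) : R :=
  \sum_c u 0 c * v 0 c.

Definition enorm (R : realType) (n : nat) (u : 'rV[R]_n) : R :=
  Num.sqrt (dot u u).

Definition enorm2 (R : realType) (t : R * R) : R :=
  Num.sqrt (t.1 ^+ 2 + t.2 ^+ 2).

Section Surface.
Variables (R : realType) (n : nat).
Implicit Types (S : R * R -> 'rV[R]_n) (t : R * R) (i j : 'I_2).

Definition basis2 i : R * R := if i == 0 then (1, 0) else (0, 1).

Definition partial_deriv i S t : 'rV[R]_n := 'D_(basis2 i) S t.

Definition metric S t : 'M[R]_2 :=
  \matrix_(i, j) dot (partial_deriv i S t) (partial_deriv j S t).

Definition vol_density S t : R :=
  Num.sqrt (metric S t 0 0 * metric S t 1 1 - metric S t 0 1 ^+ 2).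

(* As in mxalgebra, a matrix stands for its row space. *)
Definition tangent_subspace S t : 'M[R]_n := <<\matrix_i partial_deriv i S t>>%MS.

Definition normal_subspace S t : 'M[R]_n := kermx (tangent_subspace S t)^T.

(* Since the tangent space is the orthogonal complement of the normal space,
   projecting onto the latter parallel to the former is the orthogonal
   projection. *)
Definition normal_proj S t (v : 'rV[R]_n) : 'rV[R]_n :=
  v *m proj_mx (normal_subspace S t) (tangent_subspace S t).

Definition second_form S t i j : 'rV[R]_n :=
  normal_proj S t (partial_deriv i (partial_deriv j S) t).

Definition mean_curvature S t : 'rV[R]_n :=
  \sum_i \sum_j invmx (metric S t) i j *: second_form S t i j.

(* The vector field V along S belongs to L^q(S, dvol), where
   dvol = g dt_1 dt_2. *)
Definition in_Lq_dvol (q : nat) S (V : R * R -> 'rV[R]_n) : Prop :=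
  (forall c : 'I_n, measurable_fun setT (fun t => V t 0 c)) /\
  (\int[lebesgue_measure \x lebesgue_measure]_(t in setT)
     (enorm (V t) ^+ q * vol_density S t)%:E < +oo)%E.

End Surface.

(* Main.v *)
(* Write w_c for the coordinate functions exp <q_c, t> and [c, d] for the
   determinant of two exponents. By Lagrange's identity
   2 g^2 = sum_{c,d} [c, d]^2 w_c^2 w_d^2, and g^2 H is the normal projection of
   the vector X with X_c = w_c sum_d [c, d]^2 w_d^2. Each summand of X is at most
   a constant times g W, where W is the largest weight, so ||H|| <= C W / g and
   ||H||^3 g <= C W^3 / g^2.
   In each quadrant W is the weight of a corner c of the grid of exponents
   (r_i, s_j). Its two grid neighbours d, e are not collinear with c, hence
   g^2 >= C W^2 max(w_d, w_e)^2 >= C W^2 w_d w_e, and W / (w_d w_e) is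
   exp (- (r t_1 + s t_2)) for the roots r, s next to the extreme ones, which
   have the signs of t_1, t_2. *)

Require Import Defs.
From mathcomp Require Import all_boot all_order all_algebra.
From mathcomp Require Import all_classical all_reals all_analysis.
From mathcomp Require Import measurable_realfun ring lra.
From mathcomp Require mxtens.

Import Order.TTheory GRing.Theory Num.Theory.
Import numFieldNormedType.Exports.

Local Open Scope classical_set_scope.
Local Open Scope ring_scope.

(** * Partial derivatives of exponential sums *)

Section ExponentialMap.
Context {R : realType} {n : nat}.
Variable q : 'I_2 -> 'I_n -> R.
Implicit Types (t : R * R) (i j : 'I_2) (c d : 'I_n) (f : 'I_n -> R).

Definition weight c t : R := expR (q 0 c * t.1 + q 1 c * t.2).

(** The amplitudes [f] make the family closed under differentiation: a partial derivative only
    multiplies [f c] by [q i c]. *)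
Definition exp_map f t : 'rV[R]_n := \row_c (f c * weight c t).

Lemma weight_gt0 c t : 0 < weight c t.
Proof. exact: expR_gt0. Qed.

Lemma is_derive_weight i c t :
  is_derive t (basis2 R i) (weight c) (q i c * weight c t).
Proof.
have qE : q i c = q 0 c * (basis2 R i).1 + q 1 c * (basis2 R i).2.
  rewrite /basis2; case: i => -[|[|//]] ilt; rewrite eqE/= mulr0 mulr1 ?addr0 ?add0r;
  by congr (q _ c); exact: val_inj.
pose g (h : R) := expR (q i c * h + (q 0 c * t.1 + q 1 c * t.2)).
have main : is_derive (0 : R) 1 g (q i c * weight c t).
  have lin : is_derive (0 : R) 1
      (fun h : R => q i c * h + (q 0 c * t.1 + q 1 c * t.2)) (q i c).
    have := is_deriveD (is_deriveZ (q i c) (is_derive_id (0 : R) (1 : R)))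
      (is_derive_cst (q 0 c * t.1 + q 1 c * t.2) (0 : R) (1 : R)).
    by rewrite addr0 /GRing.scale/= mulr1.
  have := @is_derive1_comp R expR _ 0 _ _ (is_derive_expR _) lin.
  by rewrite mulr0 add0r [_ * q i c]mulrC.
(* On the line through [t] along [basis2 R i] the weight is the function [g] of one variable. The
   difference quotients agree, so derivability and value carry over. *)
have fE : (fun h : R => h^-1 *: (weight c (h *: basis2 R i + t) - weight c t)) =
    fun h : R => h^-1 *: (g (h *: 1 + 0) - g 0).
  apply/funext => h; rewrite /g mulr0 add0r addr0 /weight /= qE.
  congr (_ *: (expR _ - _)).
  by rewrite /GRing.scale/= mulr1; ring.
case: main => D1 D2; split; first by rewrite /derivable fE.
by rewrite -D2 /derive fE.
Qed.

Lemma partial_deriv_exp_map i f :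
  partial_deriv i (exp_map f) = exp_map (fun c => q i c * f c).
Proof.
apply/funext => t; rewrite /partial_deriv.
have comp (x : 'I_1) c : is_derive t (basis2 R i) (fun u => exp_map f u x c)
    (f c *: (q i c * weight c t)).
  rewrite (_ : (fun u => _) = f c \*: weight c).
    exact/is_deriveZ/is_derive_weight.
  by apply/funext => u; rewrite mxE.
rewrite derive_mx; last first.
  by apply/derivable_mxP => x c; case: (comp x c).
apply/matrixP => x c; rewrite !mxE; case: (comp x c) => _ ->.
by rewrite /GRing.scale/= mulrCA mulrA.
Qed.

End ExponentialMap.

(** * Inversion of two-by-two matrices *)

Lemma ord2_ind (P : 'I_2 -> Prop) : P 0 -> P 1 -> forall i, P i.
Proof.
move=> P0 P1 [[|[|//]] ilt].
- by rewrite (_ : Ordinal _ = 0)//; exact/val_inj.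
- by rewrite (_ : Ordinal _ = 1)//; exact/val_inj.
Qed.

Lemma sum_ord2 {V : nmodType} (f : 'I_2 -> V) : \sum_i f i = f 0 + f 1.
Proof.
rewrite !big_ord_recl big_ord0 addr0; congr (_ + f _); exact/val_inj.
Qed.

(** Cramer's rule: [rev_ord] swaps the two indices, so the signed entry is a cofactor of [A]. *)
Lemma invmx_22 {F : fieldType} (A : 'M[F]_2) (d := A 0 0 * A 1 1 - A 0 1 * A 1 0) :
  d != 0 ->
  A \in unitmx /\
  invmx A = \matrix_(i, j) (d^-1 * ((-1) ^+ (i + j) * A (rev_ord j) (rev_ord i))).
Proof.
move=> d0; set B := (X in _ /\ _ = X).
have AB : A *m B = 1%:M.
  have r0 : rev_ord (0 : 'I_2) = 1 by exact/val_inj.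
  have r1 : rev_ord (1 : 'I_2) = 0 by exact/val_inj.
  apply/matrixP; elim/ord2_ind; elim/ord2_ind; rewrite !mxE sum_ord2 !mxE ?r0 ?r1 /=;
    rewrite ?addn0 ?add0n ?addn1 ?expr0 ?expr1 ?sqrrN ?expr1n;
    move: d0; rewrite /d => d0; by field.
have [Au _] := mulmx1_unit AB.
by split=> //; rewrite -[LHS]mulmx1 -AB mulKmx.
Qed.

(** * Euclidean inner product and norm *)

Section EuclideanRow.
Context {R : realType} {n : nat}.
Implicit Types u v : 'rV[R]_n.

Lemma dotE u v : dot u v = (u *m v^T) 0 0.
Proof. by rewrite mxE; apply: eq_bigr => c _; rewrite mxE. Qed.

Lemma dot_ge0 u : 0 <= dot u u.
Proof. by apply: sumr_ge0 => c _; exact: sqr_ge0. Qed.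

Lemma enorm_ge0 u : 0 <= enorm u.
Proof. exact: sqrtr_ge0. Qed.

Lemma enorm_le_sum u : enorm u <= \sum_c `|u 0 c|.
Proof.
rewrite -[leRHS]ger0_norm ?sumr_ge0// -sqrtr_sqr ler_wsqrtr//.
rewrite expr2 big_distrlr/= ler_sum// => c _.
rewrite (bigD1 c)//= -normrM [X in X + _]ger0_norm; last exact: sqr_ge0.
by rewrite lerDl sumr_ge0// => d _; rewrite mulr_ge0.
Qed.

End EuclideanRow.

(** * Orthogonal projection onto the normal space *)

Section NormalProjection.
Context {R : realType} {n : nat}.
Variables (S : R * R -> 'rV[R]_n) (t : R * R).
Hypothesis metric_unit : metric S t \in unitmx.
Implicit Type v : 'rV[R]_n.

Let T : 'M[R]_(2, n) := \matrix_i partial_deriv i S t.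

Let metricE : metric S t = T *m T^T.
Proof.
apply/matrixP => i j; rewrite !mxE; apply: eq_bigr => c _.
by rewrite !mxE.
Qed.

(** Normal equations: when the Gram matrix [T *m T^T] is invertible, this is the orthogonal
    projection onto the row space of [T]. *)
Definition tangent_part v := v *m T^T *m invmx (metric S t) *m T.

Let orth_tangent_part v : (v - tangent_part v) *m T^T = 0.
Proof.
by rewrite mulmxBl /tangent_part -[X in _ - X]mulmxA -metricE mulmxKV ?subrr.
Qed.

Let kerP v : (v <= normal_subspace S t)%MS = (v *m T^T == 0).
Proof.
have /submxP[D TE] : (T <= tangent_subspace S t)%MS by rewrite genmxE.
have /submxP[D' TE'] : (tangent_subspace S t <= T)%MS by rewrite genmxE.
apply/sub_kermxP/eqP => [v0|v0].
  by rewrite TE trmx_mul mulmxA v0 mul0mx.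
by rewrite TE' trmx_mul mulmxA v0 mul0mx.
Qed.

(** [proj_mx] acts as a projection only along a direct sum. A normal vector of the form [w *m T]
    satisfies [w *m metric S t = 0], so it vanishes. *)
Let normal_cap_tangent :
  (normal_subspace S t :&: tangent_subspace S t = 0)%MS.
Proof.
apply/eqP; rewrite -submx0; apply/rV_subP => u; rewrite sub_capmx kerP.
rewrite genmxE => /andP[/eqP uT /submxP[w uE]].
move: uT; rewrite {}uE -mulmxA -metricE => w0.
by rewrite -[w](mulmxK metric_unit) w0 !mul0mx submx0.
Qed.

Lemma normal_projE v : normal_proj S t v = v - tangent_part v.
Proof.
rewrite /normal_proj -{1}[v](subrK (tangent_part v)) mulmxDl.
rewrite (proj_mx_id normal_cap_tangent) ?kerP ?orth_tangent_part//.
by rewrite (proj_mx_0 normal_cap_tangent) ?addr0// genmxE submxMl.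
Qed.

(** Pythagoras: the normal and tangent parts of [v] are orthogonal. *)
Lemma enorm_normal_proj_le v : enorm (normal_proj S t v) <= enorm v.
Proof.
rewrite normal_projE; set p := tangent_part v; rewrite ler_wsqrtr//.
have o1 : (v - p) *m p^T = 0.
  by rewrite trmx_mul mulmxA orth_tangent_part mul0mx.
have o2 : p *m (v - p)^T = 0 by rewrite -[LHS]trmxK trmx_mul trmxK o1 trmx0.
have -> : dot v v = dot (v - p) (v - p) + dot p p.
  rewrite -{1 2}[v](subrK p) !dotE linearD/= mulmxDl !mulmxDr o1 o2.
  by rewrite addr0 add0r mxE.
by rewrite lerDl dot_ge0.
Qed.

End NormalProjection.

(** * Lagrange's identity and pointwise curvature bounds *)

Section MeanCurvatureBound.
Context {R : realType} {n : nat}.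
Variable q : 'I_2 -> 'I_n -> R.
Implicit Types (t : R * R) (i j : 'I_2) (c d : 'I_n).

Let S := exp_map q (fun=> 1).
Let w c t := weight q c t.

Definition cross c d := q 0 c * q 1 d - q 1 c * q 0 d.

(** Ordered pairs are counted, so this is twice the squared area density. *)
Definition gram t := \sum_c \sum_d (cross c d * (w c t * w d t)) ^+ 2.

Lemma gram_ge0 t : 0 <= gram t.
Proof. by do 2!apply: sumr_ge0 => ? _; exact: sqr_ge0. Qed.

Lemma gram_ge c d t : (cross c d * (w c t * w d t)) ^+ 2 <= gram t.
Proof.
rewrite /gram (bigD1 c)//= (bigD1 d)//= -addrA lerDl addr_ge0//.
  by apply: sumr_ge0 => ? _; exact: sqr_ge0.
by do 2!apply: sumr_ge0 => ? _; exact: sqr_ge0.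
Qed.

Lemma metric_exp_mapE t i j :
  metric S t i j = \sum_c q i c * q j c * w c t ^+ 2.
Proof.
rewrite mxE !partial_deriv_exp_map; apply: eq_bigr => c _.
by rewrite !mxE !mulr1 mulrACA -expr2.
Qed.

Lemma metric_exp_map_sym t : metric S t 1 0 = metric S t 0 1.
Proof. by rewrite !metric_exp_mapE; apply: eq_bigr => c _; rewrite [q 1 c * _]mulrC. Qed.

(** Lagrange's identity. Each term of [gram t] expands to [F c d + F d c - 2 * G c d], and the two
    sums of [F] agree after exchanging [c] and [d]. *)
Lemma gram_metric t :
  metric S t 0 0 * metric S t 1 1 - metric S t 0 1 ^+ 2 = gram t / 2.
Proof.
pose F c d := q 0 c ^+ 2 * q 1 d ^+ 2 * (w c t * w d t) ^+ 2.
pose G c d := q 0 c * q 1 c * (q 0 d * q 1 d) * (w c t * w d t) ^+ 2.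
have -> : gram t = \sum_c \sum_d F c d + \sum_c \sum_d F d c
    - (\sum_c \sum_d G c d) *+ 2.
  rewrite mulr2n -!big_split -sumrB/=; apply: eq_bigr => c _.
  rewrite -!big_split -sumrB/=; apply: eq_bigr => d _.
  by rewrite /F /G /cross; ring.
have -> : metric S t 0 0 * metric S t 1 1 = \sum_c \sum_d F c d.
  rewrite !metric_exp_mapE big_distrlr; apply: eq_bigr => c _.
  by apply: eq_bigr => d _; rewrite /F/=; ring.
have -> : metric S t 0 1 ^+ 2 = \sum_c \sum_d G c d.
  rewrite !metric_exp_mapE expr2 big_distrlr; apply: eq_bigr => c _.
  by apply: eq_bigr => d _; rewrite /G/=; ring.
by rewrite [X in _ + X - _]exchange_big/=; field.
Qed.

Lemma vol_density_exp_map t : vol_density S t = Num.sqrt (gram t / 2).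
Proof. by rewrite /vol_density gram_metric. Qed.

Let det_metric t : metric S t 0 0 * metric S t 1 1 - metric S t 0 1 * metric S t 1 0
  = gram t / 2.
Proof. by rewrite metric_exp_map_sym -expr2 gram_metric. Qed.

Lemma metric_exp_map_unit t : 0 < gram t -> metric S t \in unitmx.
Proof.
by move=> g0; apply: (proj1 (invmx_22 _ _)); rewrite det_metric gt_eqF// divr_gt0.
Qed.

Lemma invmx_metric_exp_map t i j : 0 < gram t ->
  invmx (metric S t) i j =
  2 / gram t * ((-1) ^+ (i + j) * metric S t (rev_ord j) (rev_ord i)).
Proof.
move=> g0; have [|_ ->] := invmx_22 (metric S t).
  by rewrite det_metric gt_eqF// divr_gt0.
by rewrite mxE det_metric invf_div.
Qed.

(** Up to the factor [2 / gram t], this is the metric trace of the second derivatives before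
    projection onto the normal space. *)
Definition curv_vector t : 'rV[R]_n :=
  \row_c \sum_d w c t * w d t ^+ 2 * cross c d ^+ 2.

(* The entry at [c] of [\sum_(i, j) g^ij *: 'D_i 'D_j S] is [w c t] times the
   quadratic form [g^-1] at [(q 0 c, q 1 c)], i.e. a sum of squared crosses. *)
Lemma mean_curvature_exp_map t : 0 < gram t ->
  mean_curvature S t = (2 / gram t) *: normal_proj S t (curv_vector t).
Proof.
move=> g0; rewrite /mean_curvature /second_form /normal_proj.
under eq_bigr do under eq_bigr do rewrite scalemxAl.
under eq_bigr do rewrite -mulmx_suml.
rewrite -mulmx_suml scalemxAl; congr (_ *m _).
have r0 : rev_ord (0 : 'I_2) = 1 by exact/val_inj.
have r1 : rev_ord (1 : 'I_2) = 0 by exact/val_inj.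
pose G i j := \sum_c q i c * q j c * w c t ^+ 2.
have D2 i j : partial_deriv i (partial_deriv j S) t =
    \row_c (q i c * q j c * w c t).
  rewrite /S 2!partial_deriv_exp_map; apply/rowP => c.
  by rewrite /exp_map !mxE mulr1.
under eq_bigr do under eq_bigr do
  rewrite D2 invmx_metric_exp_map// metric_exp_mapE -/(G _ _).
have G10 : G 1 0 = G 0 1 by apply: eq_bigr => c _; rewrite [q 1 c * _]mulrC.
rewrite !sum_ord2 r0 r1 G10.
rewrite /= addn0 add0n addn1 expr0 expr1 sqrrN expr1n.
apply/rowP => c; rewrite !mxE.
rewrite [LHS](_ : _ = 2 / gram t * w c t *
  (q 0 c ^+ 2 * G 1 1 + (- 2 * q 0 c * q 1 c) * G 0 1 + q 1 c ^+ 2 * G 0 0)); last by ring.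
rewrite -mulrA; congr (_ * _); rewrite /G !mulr_sumr -!big_split /= mulr_sumr.
apply: eq_bigr => d _; rewrite /cross; ring.
Qed.

Let K : R := \sum_c \sum_d `|cross c d|.

Lemma enorm_curv_vector_le t W : (forall c, w c t <= W) ->
  enorm (curv_vector t) <= K * (W * Num.sqrt (gram t)).
Proof.
move=> wW; apply: le_trans (enorm_le_sum _) _; rewrite mulr_suml.
apply: ler_sum => c _; rewrite mulr_suml mxE; apply: le_trans (ler_norm_sum _ _ _) _.
apply: ler_sum => d _.
(* The inner product is the root of one term of [gram t], up to sign. The single [w d t] is bounded
   by [W], and the remaining cross goes into [K]. *)
have -> : w c t * w d t ^+ 2 * cross c d ^+ 2 =
  cross c d * (w d t * (cross c d * (w c t * w d t))) by ring.
rewrite 2!normrM ler_wpM2l// ler_pM//.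
  by rewrite gtr0_norm ?weight_gt0.
by rewrite -sqrtr_sqr ler_wsqrtr// gram_ge.
Qed.

Lemma mean_curvature_exp_map_le t W : 0 < gram t -> (forall c, w c t <= W) ->
  enorm (mean_curvature S t) <= 2 * K * (W / Num.sqrt (gram t)).
Proof.
move=> g0 wW; rewrite mean_curvature_exp_map//.
have enormZ a (u : 'rV[R]_n) : 0 <= a -> enorm (a *: u) = a * enorm u.
  move=> a0; rewrite /enorm -[a in RHS]ger0_norm// -sqrtr_sqr -sqrtrM ?sqr_ge0//.
  congr Num.sqrt; rewrite /dot mulr_sumr; apply: eq_bigr => c _.
  by rewrite !mxE; ring.
have s0 : Num.sqrt (gram t) != 0 by rewrite gt_eqF// sqrtr_gt0.
rewrite enormZ ?divr_ge0 ?gram_ge0//.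
have -> : 2 * K * (W / Num.sqrt (gram t)) =
    2 / gram t * (K * (W * Num.sqrt (gram t))).
  by rewrite -{2}[gram t]sqr_sqrtr ?gram_ge0//; field.
rewrite ler_wpM2l ?divr_ge0 ?gram_ge0//.
apply: le_trans (enorm_normal_proj_le _ _ _ _) _; first exact: metric_exp_map_unit.
exact: enorm_curv_vector_le.
Qed.

(** There are finitely many pairs; the default [1] keeps the minimum positive when every cross
    vanishes. *)
Lemma cross_sqr_min :
  exists2 k : R, 0 < k & forall c d, cross c d != 0 -> k <= cross c d ^+ 2.
Proof.
exists (\big[Num.min/1]_(p : 'I_n * 'I_n | cross p.1 p.2 != 0) cross p.1 p.2 ^+ 2).
  by apply/bigmin_gtP; split=> // p ?; rewrite exprn_even_gt0.
by move=> c d cd; exact: (bigmin_le_cond _ (fun p => cross p.1 p.2 ^+ 2) (j := (c, d))).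
Qed.

Let expo c t := q 0 c * t.1 + q 1 c * t.2.

(* [c] is the dominant exponent at [t], and [d], [e] are two exponents not
   collinear with it, so that [gram t] is at least of order
   [w c ^+ 2 * maxr (w d ^+ 2) (w e ^+ 2)], hence of order [w c ^+ 2 * w d * w e]. *)
Lemma gram_dominant k c d e t : 0 < k ->
    k <= cross c d ^+ 2 -> k <= cross c e ^+ 2 ->
  k * w c t ^+ 2 * (w d t * w e t) <= gram t.
Proof.
move=> k0.
wlog de : d e / w d t <= w e t.
  move=> h; have [/h//|/ltW/h h' kd ke] := leP (w d t) (w e t).
  by rewrite [w d t * _]mulrC h'.
move=> _ ke; apply: le_trans (gram_ge c e t).
have w0 := fun c => ltW (weight_gt0 q c t).
have -> : (cross c e * (w c t * w e t)) ^+ 2 =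
  cross c e ^+ 2 * w c t ^+ 2 * (w e t * w e t) by ring.
apply: ler_pM; rewrite ?mulr_ge0 ?sqr_ge0 ?(ltW k0)//.
  by rewrite ler_wpM2r ?sqr_ge0.
by rewrite ler_wpM2r.
Qed.

(** Meant for [W = w c t], [P = w d t * w e t], [E = expR (- N)] and [g = gram t]. Dividing by the
    lower bound on [g] gives [W ^+ 2 / g <= 1 / (k * P) <= E ^+ 2 / k] and
    [W ^+ 3 / g <= W / (k * P) <= E / k]. *)
Lemma decay_of_growth (k W P E g : R) : 0 < k -> 0 < W -> 0 < P -> 0 < E ->
    k * W ^+ 2 * P <= g -> W <= P * E -> 1 <= P * E ^+ 2 ->
  W / Num.sqrt g <= E / Num.sqrt k /\ W ^+ 3 / g <= E / k.
Proof.
move=> k0 W0 P0 E0 Pg WP PE.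
have g0 : 0 < g by apply: lt_le_trans Pg; rewrite !mulr_gt0 ?exprn_gt0.
have kW0 : 0 < k * W ^+ 2 by rewrite mulr_gt0 ?exprn_gt0.
have Eg : E * (k * W ^+ 2 * P) <= E * g by rewrite ler_wpM2l// ltW.
split.
  rewrite ler_pdivrMr ?sqrtr_gt0// mulrAC ler_pdivlMr ?sqrtr_gt0//.
  have sqrtM x y : 0 < x -> x * Num.sqrt y = Num.sqrt (x ^+ 2 * y).
    by move=> x0; rewrite sqrtrM ?sqr_ge0// sqrtr_sqr gtr0_norm.
  rewrite !sqrtM// ler_wsqrtr//.
  have : E * (E * (k * W ^+ 2 * P)) <= E * (E * g) by rewrite ler_wpM2l// ltW.
  have : k * W ^+ 2 * 1 <= k * W ^+ 2 * (P * E ^+ 2) by rewrite ler_wpM2l// ltW.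
  by lra.
rewrite ler_pdivrMr// mulrAC ler_pdivlMr//; apply: le_trans Eg.
have : k * W ^+ 2 * W <= k * W ^+ 2 * (P * E) by rewrite ler_wpM2l// ltW.
by lra.
Qed.

(* The last two bounds say [w c >= expR N] and [w c <= w d * w e * expR (- N)]. *)
Definition dominant_at (N : R) t := exists c d e,
  [/\ cross c d != 0, cross c e != 0, forall f, w f t <= w c t,
      N <= expo c t & N <= expo d t + expo e t - expo c t].

Lemma mean_curvature_decay : exists2 C : R, 0 < C &
  forall N t, 0 <= N -> dominant_at N t ->
    [/\ 0 < gram t, enorm (mean_curvature S t) <= C * expR (- N)
      & enorm (mean_curvature S t) ^+ 3 * vol_density S t <= C * expR (- N)].
Proof.
have [k k0 kP] := cross_sqr_min.
have K0 : 0 <= K by do 2!apply: sumr_ge0 => ? _; exact: normr_ge0.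
have K2 : 0 <= 2 * K by rewrite mulr_ge0.
pose C1 := 2 * K / Num.sqrt k; pose C2 := (2 * K) ^+ 3 / k.
have C10 : 0 <= C1 by rewrite divr_ge0 ?sqrtr_ge0.
have C20 : 0 <= C2 by rewrite divr_ge0 ?exprn_ge0 ?(ltW k0).
(* One constant, independent of [N] and [t], serves both bounds. The [1] makes it positive, [C1] and
   [C2] being only nonnegative. *)
exists (C1 + C2 + 1); first by rewrite ltr_wpDl ?addr_ge0 ?ltr01.
move=> N t N0 [c [d [e [cd ce cW Nc Nde]]]].
have w0 f : 0 < w f t by exact: weight_gt0.
have gP := gram_dominant _ _ _ _ t k0 (kP _ _ cd) (kP _ _ ce).
have g0 : 0 < gram t by apply: lt_le_trans gP; rewrite !mulr_gt0 ?exprn_gt0.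
have [||||h1 h2] := decay_of_growth _ _ _ (expR (- N)) _ k0 (w0 c) _ _ gP.
- by rewrite mulr_gt0.
- exact: expR_gt0.
- by rewrite /w /weight -!expRD ler_expR; move: Nde; rewrite /expo; lra.
(* Here [expo d t + expo e t >= expo c t + N >= 2 * N]. *)
- rewrite /w /weight expr2 -!expRD -[leLHS]expR0 ler_expR.
  by move: Nc Nde; rewrite /expo; lra.
have H0 := enorm_ge0 (mean_curvature S t).
have H1 := mean_curvature_exp_map_le _ _ g0 cW.
split=> //.
  apply: le_trans H1 _; apply: (@le_trans _ _ (C1 * expR (- N))).
    by rewrite /C1 [leRHS]mulrAC -[leRHS]mulrA ler_wpM2l.
  by rewrite ler_wpM2r ?expR_ge0// -addrA lerDl addr_ge0.
apply: (@le_trans _ _ (C2 * expR (- N))); last first.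
  by rewrite ler_wpM2r ?expR_ge0// [C1 + _]addrC -addrA lerDl addr_ge0.
set s := Num.sqrt (gram t) in H1.
have s0 : 0 < s by rewrite sqrtr_gt0.
have gs : gram t = s ^+ 2 by rewrite sqr_sqrtr ?gram_ge0.
have vs : vol_density S t <= s.
  rewrite vol_density_exp_map ler_wsqrtr//; rewrite ler_pdivrMr//.
  by rewrite ler_peMr ?gram_ge0// ler1n.
(* The cube brings [s ^+ 3] into the denominator and the density cancels one [s], which leaves the
   second quantity of [decay_of_growth]. *)
apply: (@le_trans _ _ ((2 * K * (w c t / s)) ^+ 3 * s)).
  by rewrite ler_pM ?exprn_ge0 ?sqrtr_ge0// lerXn2r ?nnegrE// mulr_ge0// divr_ge0 ?ltW.
have -> : (2 * K * (w c t / s)) ^+ 3 * s = (2 * K) ^+ 3 * (w c t ^+ 3 / gram t).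
  by rewrite gs; field; rewrite gt_eqF.
by rewrite /C2 [leRHS]mulrAC -[leRHS]mulrA ler_wpM2l ?exprn_ge0.
Qed.

End MeanCurvatureBound.

(** * Entrywise measurability of matrix-valued maps *)

Section Measurability.
Context {d : measure_display} {T : measurableType d} {R : realType}.

Definition measurable_mx m p (F : T -> 'M[R]_(m, p)) :=
  forall i j, measurable_fun setT (fun t => F t i j).

Lemma measurable_mx_mul m p r (F : T -> 'M[R]_(m, p)) (G : T -> 'M[R]_(p, r)) :
  measurable_mx m p F -> measurable_mx p r G ->
  measurable_mx m r (fun t => F t *m G t).
Proof.
move=> mF mG i j; under eq_fun do rewrite mxE.
by apply: measurable_sum => k; exact: measurable_funM.
Qed.

Lemma measurable_mx_tr m p (F : T -> 'M[R]_(m, p)) :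
  measurable_mx m p F -> measurable_mx p m (fun t => (F t)^T).
Proof. by move=> mF i j; under eq_fun do rewrite mxE; exact: mF. Qed.

Lemma measurable_fun_inv (f : T -> R) : (forall t, 0 < f t) ->
  measurable_fun setT f -> measurable_fun setT (fun t => (f t)^-1).
Proof.
(* On positive numbers the inverse is the real power [-1], a measurable function on all of [R]. *)
move=> f0 mf; under eq_fun do rewrite -powR_inv1 ?ltW//.
exact: (measurableT_comp (@measurable_powR R (-1)) mf).
Qed.

Lemma measurable_fun_sqrt (f : T -> R) :
  measurable_fun setT f -> measurable_fun setT (fun t => Num.sqrt (f t)).
Proof.
apply: measurableT_comp; apply: continuous_measurable_fun; exact: sqrt_continuous.
Qed.

Lemma measurable_fun_enorm p (F : T -> 'rV[R]_p) :
  measurable_mx 1 p F -> measurable_fun setT (fun t => enorm (F t)).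
Proof.
move=> mF; apply: measurable_fun_sqrt; apply: measurable_sum => c.
exact: measurable_funM.
Qed.

End Measurability.

(** * Measurability of the volume density and of [H] *)

Section MeanCurvatureMeasurable.
Context {R : realType} {n : nat}.
Variable q : 'I_2 -> 'I_n -> R.

Let S := exp_map q (fun=> 1).

Lemma measurable_weight c : measurable_fun setT (weight q c).
Proof.
apply: measurableT_comp; first exact: measurable_expR.
by apply: measurable_funD; apply: measurable_funM.
Qed.

Lemma measurable_exp_map f : measurable_mx 1 n (exp_map q f).
Proof.
move=> i c; under eq_fun do rewrite mxE.
by apply: measurable_funM => //; exact: measurable_weight.
Qed.

Lemma measurable_gram : measurable_fun setT (gram q).
Proof.
do 2![apply: measurable_sum => ?]; apply: measurable_funX.
by apply: measurable_funM => //; apply: measurable_funM; exact: measurable_weight.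
Qed.

Lemma measurable_vol_density : measurable_fun setT (vol_density S).
Proof.
rewrite (funext (vol_density_exp_map q)).
by apply: measurable_fun_sqrt; apply: measurable_funM => //; exact: measurable_gram.
Qed.

(** Positivity of [gram] at every [t] makes the closed formula for [H] valid on the whole plane, and
    that formula uses only weights, [1 / gram], sums and products. *)
Lemma measurable_mean_curvature : (forall t, 0 < gram q t) ->
  measurable_mx 1 n (mean_curvature S).
Proof.
move=> g0.
have mT : measurable_mx 2 n (fun t => \matrix_i partial_deriv i S t).
  move=> i c; under eq_fun do rewrite mxE partial_deriv_exp_map.
  exact: measurable_exp_map.
have mG : measurable_mx 2 2 (metric S).
  move=> i j; under eq_fun do rewrite metric_exp_mapE.
  apply: measurable_sum => c; apply: measurable_funM => //.
  by apply: measurable_funX; exact: measurable_weight.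
have mX : measurable_mx 1 n (curv_vector q).
  move=> i c; under eq_fun do rewrite mxE.
  apply: measurable_sum => e; apply: measurable_funM => //; apply: measurable_funM.
    exact: measurable_weight.
  by apply: measurable_funX; exact: measurable_weight.
have mgV := measurable_fun_inv _ g0 measurable_gram.
have mGV : measurable_mx 2 2 (fun t => invmx (metric S t)).
  move=> i j; under eq_fun do rewrite invmx_metric_exp_map//.
  by apply: measurable_funM; apply: measurable_funM.
have mP : measurable_mx 1 n (fun t => tangent_part S t (curv_vector q t)).
  apply: measurable_mx_mul => //; apply: measurable_mx_mul => //.
  by apply: measurable_mx_mul => //; apply: measurable_mx_tr.
move=> i c.
under eq_fun => t do
  rewrite mean_curvature_exp_map// normal_projE ?metric_exp_map_unit// mxE
    [in X in _ * X]mxE [in X in _ + X]mxE.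
by apply: measurable_funM; [apply: measurable_funM|apply: measurable_funB].
Qed.

End MeanCurvatureMeasurable.

(** * Integrability of exponential decay on the line and the plane *)

Section ExponentialDecay.
Context {R : realType}.
Notation mu := (@lebesgue_measure R).

Lemma continuous_expR_norm (a : R) : continuous (fun x : R => expR (a * `|x|)).
Proof.
move=> x; apply: continuous_comp; last exact: continuous_expR.
by apply: continuousM; [exact: cst_continuous|exact: norm_continuous].
Qed.

Lemma measurable_expR_norm (a : R) :
  measurable_fun setT (fun x : R => expR (a * `|x|)).
Proof. exact: continuous_measurable_fun (continuous_expR_norm a). Qed.

(** By evenness it is enough to integrate over the half-line, where the integrand is [eps^-1] times
    the density of the exponential law, of total mass one. *)
Lemma integral_expR_norm_lty (eps : R) : 0 < eps ->
  (\int[mu]_x (expR (- eps * `|x|))%:E < +oo)%E.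
Proof.
move=> e0; rewrite ge0_symfun_integralT; last 3 first.
- by move=> x; exact: expR_ge0.
- exact: continuous_expR_norm.
- by move=> x /=; rewrite normrN.
set D := [set x : R | 0 <= x].
have mD : measurable D by rewrite /D -set_itvcy.
have -> : (\int[mu]_(x in D) (expR (- eps * `|x|))%:E =
    \int[mu]_(x in D) ((eps^-1)%:E * (exponential_pdf eps x)%:E))%E.
  apply: eq_integral => x; rewrite inE /D/= => x0.
  by rewrite exponential_pdfE// ger0_norm// -EFinM mulKf ?gt_eqF.
have mpdf A : measurable_fun A (EFin \o exponential_pdf eps).
  apply: measurable_funTS; apply/measurable_EFinP; exact: measurable_exponential_pdf.
have pdf0 x : (0 <= (exponential_pdf eps x)%:E)%E.
  by rewrite lee_fin exponential_pdf_ge0// ltW.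
rewrite ge0_integralZl//; last 2 first.
- exact: mpdf.
- by rewrite lee_fin invr_ge0 ltW.
rewrite muleA -EFinM lte_mul_pinfty//; first by rewrite lee_fin mulr_ge0// invr_ge0 ltW.
apply: (@le_lt_trans _ _ (\int[mu]_x (exponential_pdf eps x)%:E)%E).
  apply: ge0_subset_integral => //; first exact: (mpdf setT).
by rewrite integral_exponential_pdf// ltry.
Qed.

(** The integrand is a product of functions of one coordinate each, so Tonelli's theorem reduces it
    to the line. *)
Lemma integral2_expR_norm_lty (eps : R) : 0 < eps ->
  (\int[mu \x mu]_t (expR (- (eps * (`|t.1| + `|t.2|))))%:E < +oo)%E.
Proof.
move=> e0.
pose f (x : R) := expR (- eps * `|x|).
have f0 x : 0 <= f x by exact: expR_ge0.
have mf : measurable_fun setT f by exact: measurable_expR_norm.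
have mEf : measurable_fun setT (EFin \o f) by exact/measurable_EFinP.
have -> : (fun t : R * R => (expR (- (eps * (`|t.1| + `|t.2|))))%:E) =
    (fun t => (f t.1 * f t.2)%:E).
  by apply/funext => t; rewrite /f -expRD -mulrDr mulNr.
rewrite fubini_tonelli1; last 2 first.
- apply/measurable_EFinP; apply: measurable_funM.
    exact: measurableT_comp mf measurable_fst.
  exact: measurableT_comp mf measurable_snd.
- by move=> t; rewrite lee_fin mulr_ge0.
have I0 : (0 <= \int[mu]_x (f x)%:E)%E by apply: integral_ge0 => x _; rewrite lee_fin.
have inner x : (\int[mu]_y (f x * f y)%:E = (f x)%:E * \int[mu]_y (f y)%:E)%E.
  under eq_integral do rewrite EFinM.
  by rewrite ge0_integralZl ?lee_fin// => y _; rewrite lee_fin.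
suff : (\int[mu]_x \int[mu]_y (f x * f y)%:E < +oo)%E by [].
under eq_integral do rewrite inner.
rewrite ge0_integralZr//; last by move=> y _; rewrite lee_fin.
rewrite lte_mul_pinfty//; last exact: integral_expR_norm_lty.
by rewrite ge0_fin_numE//; exact: integral_expR_norm_lty.
Qed.

End ExponentialDecay.

(** * From dominant exponents to decay and integrability *)

Section Conclusion.
Context {R : realType} {n : nat}.
Variable q : 'I_2 -> 'I_n -> R.
Let S := exp_map q (fun=> 1).
Let H := mean_curvature S.

(** The rate uses the sum of the absolute values of the coordinates: it bounds the Euclidean norm
    from above, which gives (1), and it makes the majorant of [||H||^3 g] a product, which gives
    (2). *)
Lemma exp_map_decay (eps : R) : 0 < eps ->
    (forall t, dominant_at q (eps * (`|t.1| + `|t.2|)) t) ->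
  (exists eps C : R, [/\ 0 < eps, 0 < C
     & forall t : R * R, enorm (H t) <= C * expR (- eps * enorm2 t)])
  /\ in_Lq_dvol 3 S H.
Proof.
move=> e0 dom; have [C C0 HC] := mean_curvature_decay q.
have N0 (t : R * R) : 0 <= eps * (`|t.1| + `|t.2|).
  by rewrite mulr_ge0 ?addr_ge0// ltW.
have {dom}HC t := HC _ t (N0 t) (dom t).
have g0 t : 0 < gram q t by case: (HC t).
have mH := measurable_mean_curvature q g0.
split; [exists eps, C; split=> // t|split=> [c|]].
- case: (HC t) => _ + _; move/le_trans; apply.
  rewrite ler_pM2l// ler_expR mulNr lerN2 ler_pM2l//.
  rewrite -[leRHS]ger0_norm ?addr_ge0// -sqrtr_sqr ler_wsqrtr//.
  rewrite -[t.1 ^+ 2]real_normK ?num_real// -[t.2 ^+ 2]real_normK ?num_real//.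
  by rewrite sqrrD addrAC lerDl mulrn_wge0 ?mulr_ge0.
- exact: mH.
- have CE0 t : 0 <= C * expR (- (eps * (`|t.1| + `|t.2|))).
    by rewrite mulr_ge0 ?expR_ge0 ?ltW.
  have mE : measurable_fun setT
      (fun t : R * R => (expR (- (eps * (`|t.1| + `|t.2|))))%:E).
    apply/measurable_EFinP/measurableT_comp; first exact: measurable_expR.
    apply: measurable_funN; apply: measurable_funM => //.
    by apply: measurable_funD; apply: measurableT_comp.
  apply: (@le_lt_trans _ _ (\int[lebesgue_measure \x lebesgue_measure]_t
      (C%:E * (expR (- (eps * (`|t.1| + `|t.2|))))%:E))%E).
    apply: ge0_le_integral => //.
    + by move=> t _; rewrite lee_fin mulr_ge0 ?exprn_ge0 ?enorm_ge0 ?sqrtr_ge0.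
    + apply/measurable_EFinP; apply: measurable_funM; last exact: measurable_vol_density.
      by apply: measurable_funX; exact: measurable_fun_enorm.
    + exact: measurable_funeM.
    + by move=> t _; rewrite -EFinM lee_fin; case: (HC t).
  rewrite ge0_integralZl ?lee_fin ?(ltW C0)//.
  by apply: lte_mul_pinfty; rewrite ?lee_fin ?(ltW C0)//; exact: integral2_expR_norm_lty.
Qed.

End Conclusion.

(** * Extreme roots, their neighbours, and the grid of exponents *)

Lemma root_growth {R : realType} {k : nat} (r : k.-tuple R) :
    sorted >%R r ->
    [/\ r`_0 > r`_1, r`_1 > 0, 0 > r`_k.-2 & r`_k.-2 > r`_k.-1] ->
  exists2 eps : R, 0 < eps & forall x, exists i j : 'I_k,
    [/\ tnth r i != 0, tnth r i != tnth r j,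
        forall m, tnth r m * x <= tnth r i * x
      & eps * `|x| <= tnth r j * x].
Proof.
move=> rs [r01 r1 rk2 rk12].
(* With at most one root, the entry of index 1 would be the default value [0], which is not
   positive. *)
have k1 : (1 < k)%N.
  by rewrite ltnNge; apply/negP => k1; move: r1; rewrite nth_default ?size_tuple ?ltxx.
have k0 : (0 < k)%N := ltnW k1.
have mono (a b : nat) : (a <= b)%N -> (b < k)%N -> r`_b <= r`_a.
  rewrite leq_eqVlt => /orP[/eqP -> //|ab bk]; apply/ltW.
  have gt_trans : transitive (>%R : rel R) by move=> ? ? ? /[swap]; exact: lt_trans.
  apply: (sorted_ltn_nth gt_trans 0 rs) => //; rewrite inE size_tuple//.
  exact: ltn_trans bk.
have k1k : (k.-1 < k)%N by rewrite prednK.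
have k2k : (k.-2 < k)%N by rewrite (leq_ltn_trans (leq_pred _)).
(* These are the growth rates of the roots next to the extreme ones. For [x >= 0] the largest root
   dominates and its neighbour has index 1; for [x < 0] the order is reversed and the indices are
   [k.-1] and [k.-2]. *)
exists (Num.min r`_1 (- r`_k.-2)); first by rewrite lt_min r1 oppr_gt0.
move=> x; have [x0|x0] := leP 0 x.
- exists (Ordinal k0), (Ordinal k1); rewrite !(tnth_nth 0)/=; split.
  + by rewrite gt_eqF// (lt_trans r1).
  + by rewrite gt_eqF.
  + by move=> m; rewrite (tnth_nth 0) ler_wpM2r// mono.
  + by rewrite ger0_norm// ler_wpM2r// ge_min lexx.
- exists (Ordinal k1k), (Ordinal k2k); rewrite !(tnth_nth 0)/=; split.
  + by rewrite lt_eqF// (lt_trans rk12).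
  + by rewrite lt_eqF.
  + by move=> m; rewrite (tnth_nth 0) ler_wnM2r ?(ltW x0)// mono// -ltnS prednK.
  + by rewrite ltr0_norm// -[leRHS]mulrNN ler_wpM2r ?oppr_ge0 ?(ltW x0)// ge_min lexx orbT.
Qed.

Theorem theorem1p15 (R : realType) (P1 P2 : (R -> R) -> R -> R)
    (p1 p2 : {poly R}) (k l : nat) (r : k.-tuple R) (s : l.-tuple R)
    (charP1 : has_charpoly P1 p1) (charP2 : has_charpoly P2 p2)
    (roots1 : real_simple_roots p1 r) (roots2 : real_simple_roots p2 s)
    (dom1 : dominant_real_roots r) (dom2 : dominant_real_roots s)
    (hr : [/\ r`_0 > r`_1, r`_1 > 0, 0 > r`_k.-2 & r`_k.-2 > r`_k.-1])
    (hs : [/\ s`_0 > s`_1, s`_1 > 0, 0 > s`_l.-2 & s`_l.-2 > s`_l.-1]) :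
  let Sigma := exp_surface r s in
  let H := mean_curvature Sigma in
  (exists eps C : R, [/\ 0 < eps, 0 < C
     & forall t : R * R, enorm (H t) <= C * expR (- eps * enorm2 t)])
  /\ in_Lq_dvol 3 Sigma H.
Proof.
move=> Sigma H.
have [_ sorted_r _] := roots1; have [_ sorted_s _] := roots2.
have [e1 e10 growth1] := root_growth r sorted_r hr.
have [e2 e20 growth2] := root_growth s sorted_s hs.
pose idx := @mxtens.mxtens_index k l.
(* The tensor coordinate of index pair [(i, j)] has exponent [(r_i, s_j)]. *)
pose q (i : 'I_2) (c : 'I_(k * l)) :=
  if i == 0 then tnth r (mxtens.mxtens_unindex c).1
  else tnth s (mxtens.mxtens_unindex c).2.
have q0 i j : q 0 (idx (i, j)) = tnth r i by rewrite /q /idx mxtens.mxtens_indexK.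
have q1 i j : q 1 (idx (i, j)) = tnth s j by rewrite /q /idx mxtens.mxtens_indexK.
have SigmaE : Sigma = exp_map q (fun=> 1).
  apply/funext => t; apply/matrixP => x c; rewrite !mxE mul1r -expRD.
  by rewrite /weight /q.
rewrite /H SigmaE.
apply: (exp_map_decay q (Num.min e1 e2)); first by rewrite lt_min e10.
move=> t.
have [i [i' [ri0 ri' rmax rgrow]]] := growth1 t.1.
have [j [j' [sj0 sj' smax sgrow]]] := growth2 t.2.
have e1min : Num.min e1 e2 * `|t.1| <= e1 * `|t.1| by rewrite ler_wpM2r// ge_min lexx.
have e2min : Num.min e1 e2 * `|t.2| <= e2 * `|t.2| by rewrite ler_wpM2r// ge_min lexx orbT.
(* The corner for the quadrant of [t] and its two grid neighbours. The crosses are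
   [s_j (r_i - r_i')] and [r_i (s_j' - s_j)], products of nonzero factors. *)
exists (idx (i, j)), (idx (i', j)), (idx (i, j')); split.
- by rewrite /cross !q0 !q1 [tnth s j * _]mulrC -mulrBl mulf_neq0// subr_eq0.
- by rewrite /cross !q0 !q1 mulrC -mulrBl mulf_neq0// subr_eq0 eq_sym.
- move=> f; case: (mxtens.mxtens_indexP f) => m m'.
  by rewrite /weight !q0 !q1 ler_expR lerD.
- rewrite !q0 !q1 mulrDr; have := rmax i'; have := smax j'; lra.
(* The extreme roots cancel, leaving [r_i' t_1 + s_j' t_2]. *)
- rewrite !q0 !q1 mulrDr; lra.
Qed.
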